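(* Let $\omega$ be a nonsingular Sturmian word and $u$ a factor of $\omega$. Then $\omega|_u$ is an IP-set (respectively, a central set) if and only if $u$ is a prefix of $\omega$. Consequently, for every prefix $v$ of $\omega$ and every $n\in\omega|_v$, the set $\omega|_v-n$ is an IP$^*$-set (respectively, a central$^*$ set).
   Context: $\mathbb N=\{0,1,2,\dots\}$. For an infinite word $\omega=\omega_0\omega_1\cdots$ and a nonempty finite word $u$, $\omega|_u=\{n\in\mathbb N:\omega_n\cdots\omega_{n+|u|-1}=u\}$; for $A\subseteq\mathbb N$, $A-n=\{m\in\mathbb N: m+n\in A\}$. A Sturmian word is an infinite word over $\{0,1\}$ having exactly $k+1$ distinct factors of length $k$ for every $k\ge0$. $T$ denotes the shift $(x_n)_{n}\mapsto(x_{n+1})_n$, and $\Omega$ the shift-orbit closure of $\omega$ in $\{0,1\}^{\mathbb N}$ (product topology). The characteristic word $\tilde\omega$ is the unique element of $\Omega$ all of whose prefixes $v$ are left special (i.e. both $0v$ and $1v$ are factors of $\omega$). $\omega$ is singular if $T^n(\omega)=\tilde\omega$ for some $n\ge1$, and nonsingular otherwise. A set $A\subseteq\mathbb N$ is an IP-set if there is a sequence $x_0<x_1<\cdots$ in $\mathbb N$ with $\sum_{n\in F}x_n\in A$ for all nonempty finite $F\subseteq\mathbb N$; $A$ is IP$^*$ if it meets every IP-set. $\beta\mathbb N$ is the set of ultrafilters on $\mathbb N$ with addition $A\in p+q$ iff $\{n:A-n\in p\}\in q$; an idempotent is a non-principal $p$ with $p+p=p$; a minimal idempotent is an idempotent in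 the smallest two-sided ideal $K(\beta\mathbb N)$. $A$ is central if it belongs to some minimal idempotent, and central$^*$ if it meets every central set (equivalently belongs to every minimal idempotent). *)

(* Defs.v *)
From mathcomp Require Import all_boot.
Set Implicit Arguments. Unset Strict Implicit. Unset Printing Implicit Defensive.

Definition word := nat -> bool.

Definition occurs_at (w : word) (u : seq bool) (n : nat) : Prop :=
  forall i, i < size u -> w (n + i) = nth false u i.

Definition occ (w : word) (u : seq bool) : nat -> Prop := fun n => occurs_at w u n.

Definition factor (w : word) (u : seq bool) : Prop := exists n, occurs_at w u n.

Definition is_prefix (u : seq bool) (w : word) : Prop := occurs_at w u 0.

Definition shiftset (A : nat -> Prop) (n : nat) : nat -> Prop := fun m => A (m + n).

Definition sturmian (w : word) : Prop :=
  forall k, exists l : seq (seq bool),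
    uniq l /\ size l = k.+1 /\
    forall v, v \in l <-> (size v = k /\ factor w v).

Definition shiftn (n : nat) (x : word) : word := fun m => x (n + m).

(* x lies in the shift-orbit closure of w (product topology): every finite
   prefix of x is a prefix of some T^n w, i.e. a factor of w *)
Definition in_orbit_closure (w x : word) : Prop :=
  forall k, factor w (mkseq x k).

Definition left_special (w : word) (v : seq bool) : Prop :=
  factor w (false :: v) /\ factor w (true :: v).

Definition characteristic (w x : word) : Prop :=
  in_orbit_closure w x /\ forall k, left_special w (mkseq x k).

Definition singular (w : word) : Prop :=
  exists n, 1 <= n /\ characteristic w (shiftn n w).

Definition nonsingular (w : word) : Prop := ~ singular w.

Definition IPset (A : nat -> Prop) : Prop :=
  exists x : nat -> nat, (forall n, x n < x n.+1) /\
    forall F : seq nat, uniq F -> F <> [::] -> A (\sum_(i <- F) x i).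

Definition IPstar (A : nat -> Prop) : Prop :=
  forall B, IPset B -> exists n, A n /\ B n.

Definition ufilter := (nat -> Prop) -> Prop.

Definition is_ultrafilter (p : ufilter) : Prop :=
  p (fun _ => True) /\ ~ p (fun _ => False) /\
  (forall A B, p A -> p B -> p (fun n => A n /\ B n)) /\
  (forall A B : nat -> Prop, (forall n, A n -> B n) -> p A -> p B) /\
  (forall A, p A \/ p (fun n => ~ A n)).

Definition uadd (p q : ufilter) : ufilter :=
  fun A => q (fun n => p (shiftset A n)).

Definition principal (p : ufilter) : Prop :=
  exists m, forall A, p A <-> A m.

Definition idempotent (p : ufilter) : Prop :=
  is_ultrafilter p /\ ~ principal p /\ uadd p p = p.

Definition two_sided_ideal (I : ufilter -> Prop) : Prop :=
  (forall p, I p -> is_ultrafilter p) /\ (exists p, I p) /\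
  forall p q, I p -> is_ultrafilter q -> I (uadd p q) /\ I (uadd q p).

(* K(beta N): the smallest two-sided ideal (intersection of all of them) *)
Definition in_K (p : ufilter) : Prop :=
  is_ultrafilter p /\ forall I, two_sided_ideal I -> I p.

Definition minimal_idempotent (p : ufilter) : Prop :=
  idempotent p /\ in_K p.

Definition central (A : nat -> Prop) : Prop :=
  exists p, minimal_idempotent p /\ p A.

Definition central_star (A : nat -> Prop) : Prop :=
  forall B, central B -> exists n, A n /\ B n.

(* Main.v *)
Require Import Defs.
From mathcomp Require Import all_boot.
From mathcomp Require Import zify.
From mathcomp Require Import boolp classical_sets filter.
Set Implicit Arguments. Unset Strict Implicit. Unset Printing Implicit Defensive.

(* Every idempotent p contains the set of occurrences of every prefix of w. Let
   y be the limit of the shifts T^n w along p; idempotence makes y the limit of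
   T^n y as well. A Sturmian word is balanced, so the difference D(m) between
   the numbers of ones in the first m letters of w and of y varies by at most
   one; let d be its limit along p. If D(m) <> d then, for every l and p-many n,
   the factor of length n of w at m has fewer (or, for the other sign, more) ones
   than the factor of length n of y at l; comparing two such positions m at their
   first difference, and using that y has all the factors of w, shows that there
   is at most one. Hence w and y agree from some point on, and if they differ, what
   follows their last difference is the characteristic word and w is singular.
   The theorem then follows from the existence of minimal idempotents and the
   fact that every IP-set belongs to an idempotent. *)

(** * Factor complexity *)

Definition window (x : word) (i n : nat) : seq bool := mkseq (fun k => x (i + k)) n.

Definition ones (x : word) (i n : nat) : nat := \sum_(k < n) x (i + k).

Definition eventually_periodic (x : word) : Prop :=
  exists q N, 0 < q /\ forall i, N <= i -> x (i + q) = x i.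

Lemma windowP x y i j n :
  window x i n = window y j n <-> forall k, k < n -> x (i + k) = y (j + k).
Proof.
split=> [E k lt_kn | E].
  by have := congr1 (fun s => nth false s k) E; rewrite !nth_mkseq.
by apply: (@eq_from_nth _ false) => [|k]; rewrite !size_mkseq // => lt_kn;
  rewrite !nth_mkseq // E.
Qed.

Lemma occurs_atP x u i : occurs_at x u i <-> window x i (size u) = u.
Proof.
split=> [occ_u | <- k]; last by rewrite size_mkseq => lt_k; rewrite nth_mkseq.
by apply: (@eq_from_nth _ false) => [|k]; rewrite size_mkseq // => lt_k;
  rewrite nth_mkseq // occ_u.
Qed.

Lemma factorP x u : factor x u <-> exists i, window x i (size u) = u.
Proof. by split=> -[i /occurs_atP ui]; exists i. Qed.

Lemma factor_window x i n : factor x (window x i n).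
Proof. by apply/factorP; exists i; rewrite size_mkseq. Qed.

Lemma window_shift x i j n :
  window x i n = window x j n -> x (i + n) = x (j + n) ->
  window x i.+1 n = window x j.+1 n.
Proof.
move=> /windowP E En; apply/windowP => k lt_kn; rewrite !addSnnS.
by have [/E // | ] := ltnP k.+1 n; rewrite leq_eqVlt ltnNge lt_kn orbF => /eqP <-.
Qed.

Lemma windowS x i j n :
  window x i n.+1 = window x j n.+1 ->
  window x i n = window x j n /\ x (i + n) = x (j + n).
Proof.
by move=> /windowP E; split; [apply/windowP => k lt_kn|]; apply: E; rewrite // ltnW.
Qed.

Lemma ones_add x i m n : ones x i (m + n) = ones x i m + ones x (i + m) n.
Proof.
rewrite /ones big_split_ord; congr addn.
by apply: eq_bigr => k _ /=; rewrite addnA.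
Qed.

Lemma ones1 x i : ones x i 1 = x i.
Proof. by rewrite /ones big_ord1 addn0. Qed.

Lemma eq_ones x y i j n :
  (forall k, k < n -> x (i + k) = y (j + k)) -> ones x i n = ones y j n.
Proof. by move=> E; apply: eq_bigr => k _; rewrite E. Qed.

(** The windows at [s], ..., [s + q - 1] form a cycle: each forces its next letter, hence the next
    window, so positions [s + t] and [s + q + t] always show the same one. *)
Lemma deterministic_periodic x n s q :
  0 < q -> window x s n = window x (s + q) n ->
  (forall t j, t < q -> window x j n = window x (s + t) n ->
     x (j + n) = x (s + t + n)) ->
  eventually_periodic x.
Proof.
move=> q_gt0 Esq det.
have H t : exists t', [/\ t' < q, window x (s + t) n = window x (s + t') n
                      & window x (s + q + t) n = window x (s + t') n].
  elim: t => [|t [t' [lt_t' E1 E2]]]; first by exists 0; rewrite !addn0.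
  have D1 := window_shift E1 (det _ _ lt_t' E1).
  have D2 := window_shift E2 (det _ _ lt_t' E2).
  rewrite -!addnS in D1 D2.
  have [lt_t'q | ge_t'q] := ltnP t'.+1 q; first by exists t'.+1.
  have Eq : t'.+1 = q by apply/eqP; rewrite eqn_leq lt_t'.
  by rewrite Eq -Esq in D1 D2; exists 0; rewrite addn0.
exists q, (s + n); split=> // i le_i.
have [t' [lt_t' E1 E2]] := H (i - (s + n)).
have := det _ _ lt_t' E1; rewrite -(det _ _ lt_t' E2) => D.
have Ei : s + (i - (s + n)) + n = i by lia.
have Eiq : s + q + (i - (s + n)) + n = i + q by lia.
by rewrite -Ei D Eiq Ei.
Qed.

Lemma window_pigeonhole x n s (L : seq (seq bool)) :
  (forall t, t <= size L -> window x (s + t) n \in L) ->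
  exists t q, [/\ 0 < q, t + q <= size L
                & window x (s + t) n = window x (s + t + q) n].
Proof.
move=> inL; set W := [seq window x (s + t) n | t <- iota 0 (size L).+1].
have sW : size W = (size L).+1 by rewrite size_map size_iota.
have nuW : ~~ uniq W.
  apply/negP => uW; have : size W <= size L.
    apply: uniq_leq_size => // v /mapP[t]; rewrite mem_iota /= => lt_t ->.
    by apply: inL; rewrite add0n in lt_t.
  by rewrite sW ltnn.
have /(uniqPn [::]) [i [j [lt_ij]]] := nuW.
rewrite sW => lt_j; rewrite !(nth_map 0) ?size_iota //; last by apply: ltn_trans lt_j.
rewrite !nth_iota ?add0n //; last by apply: ltn_trans lt_j.
move=> E; exists i, (j - i); split; rewrite ?subn_gt0 //.
  by rewrite subnKC // ltnW.
by rewrite -addnA subnKC // ltnW.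
Qed.

(** A right special factor, presented by two occurrences instead of by the factor itself. *)
Definition special_pair (x : word) (n i j : nat) : Prop :=
  window x i n = window x j n /\ x (i + n) <> x (j + n).

Lemma aperiodic_special x n :
  ~ eventually_periodic x -> exists i j, special_pair x n i j.
Proof.
move=> aper; apply: contrapT => nospec; apply: aper.
pose L := [seq val t | t <- enum {:n.-tuple bool}].
have [|t [q [q_gt0 _ E]]] := @window_pigeonhole x n 0 L.
  move=> t _; have sz : size (window x (0 + t) n) == n by rewrite size_mkseq.
  by apply/mapP; exists (Tuple sz); rewrite // mem_enum.
apply: (deterministic_periodic q_gt0 E) => u j _ Ej.
by apply: contrapT => neq; apply: nospec; exists j, (0 + t + u).
Qed.

(** At most one position in [P] shows the special window, and it has only one of the two
    continuations. *)
Lemma special_pair_new x n i j (P : seq nat) :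
  special_pair x n i j -> uniq [seq window x k n | k <- P] ->
  exists2 k, k = i \/ k = j &
    window x k n.+1 \notin [seq window x k n.+1 | k <- P].
Proof.
move=> [Eij neq] uP.
have [/mapP[k Pk Ek] | newi] :=
  boolP (window x i n.+1 \in [seq window x k n.+1 | k <- P]); last by exists i; auto.
have [/mapP[l Pl El] | newj] :=
  boolP (window x j n.+1 \in [seq window x k n.+1 | k <- P]); last by exists j; auto.
have [Ek1 Ek2] := windowS Ek; have [El1 El2] := windowS El.
have kl : index k P = index l P.
  apply/eqP; rewrite -(nth_uniq [::] _ _ uP) ?size_map ?index_mem //.
  by rewrite !(nth_map 0) ?index_mem // !nth_index // -Ek1 -El1 Eij.
case: neq; rewrite Ek2 El2; congr (x (_ + n)).
by rewrite -(nth_index 0 Pk) kl nth_index.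
Qed.

Lemma uniq_windowS x n P :
  uniq [seq window x k n | k <- P] -> uniq [seq window x k n.+1 | k <- P].
Proof.
have -> : [seq window x k n | k <- P] = [seq take n v | v <- [seq window x k n.+1 | k <- P]].
  rewrite -map_comp; apply: eq_map => k /=.
  by rewrite /window /mkseq -map_take take_iota (minn_idPl _).
exact: map_uniq.
Qed.

(** The Morse-Hedlund bound: at each length a special pair supplies one more window. *)
Lemma aperiodic_complexity x n :
  ~ eventually_periodic x ->
  exists2 P : seq nat, size P = n.+1 & uniq [seq window x k n | k <- P].
Proof.
move=> aper; elim: n => [|n [P szP uP]]; first by exists [:: 0].
have [i [j ij]] := aperiodic_special n aper.
have [k _ newk] := special_pair_new ij uP.
by exists (k :: P); rewrite /= ?szP // newk uniq_windowS.
Qed.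

Lemma sturmian_size w n P :
  sturmian w -> uniq [seq window w k n | k <- P] -> size P <= n.+1.
Proof.
move=> /(_ n) [l [_ [<- lP]]] uP; rewrite -(size_map (window w ^~ n)).
apply: uniq_leq_size => // v /mapP[k _ ->]; apply/lP.
by rewrite size_mkseq; split=> //; apply: factor_window.
Qed.

(** With preperiod [N] and period [q], every window already occurs at one of the first [N + q]
    positions, which is one too few for length [N + q]. *)
Lemma sturmian_aperiodic w : sturmian w -> ~ eventually_periodic w.
Proof.
move=> st [q [N [q_gt0 per]]]; pose n := N + q.
have [l [ul [szl lP]]] := st n.
have : size l <= size [seq window w i n | i <- iota 0 n].
  apply: uniq_leq_size => // v /lP [szv /factorP [i]]; rewrite szv => <-.
  apply/mapP; elim/ltn_ind: i => i IHi.
  have [lt_i | ge_i] := ltnP i n; first by exists i; rewrite ?mem_iota.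
  have le_Ni : N <= i - q by rewrite -(leq_add2r q) subnK // (leq_trans _ ge_i) ?leq_addl.
  have le_qi : q <= i by rewrite (leq_trans _ ge_i) ?leq_addl.
  have [|k kn Ek] := IHi (i - q); first by rewrite ltn_subrL q_gt0 (leq_trans q_gt0).
  exists k => //; rewrite -Ek; apply/windowP => m _.
  have per_m := per _ (leq_trans le_Ni (leq_addr m _)).
  by rewrite -per_m addnAC subnK.
by rewrite szl size_map size_iota ltnn.
Qed.

(** Besides one extension of each of [n + 1] distinct windows, two distinct special windows would
    add two more, making [n + 3] factors of length [n + 1]. *)
Lemma special_unique w n i i' j j' :
  sturmian w -> special_pair w n i i' -> special_pair w n j j' ->
  window w i n = window w j n.
Proof.
move=> st ii' jj'; apply: contrapT => neq.
have [P szP uP] := aperiodic_complexity n (sturmian_aperiodic st).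
have [k ki newk] := special_pair_new ii' uP.
have [l lj newl] := special_pair_new jj' uP.
have uPS : uniq [seq window w m n.+1 | m <- [:: k, l & P]].
  rewrite /= newl uniq_windowS // inE negb_or newk !andbT.
  apply/negP => /eqP /windowS [Ekl _]; apply: neq.
  by case: ki lj Ekl => -> [] ->; rewrite -?ii'.1 -?jj'.1.
by have := sturmian_size st uPS; rewrite /= szP ltnn.
Qed.

(** By aperiodicity [x] has at least [n + 1] factors of length [n], so they exhaust those of [w]. *)
Lemma aperiodic_same_factors w x :
  sturmian w -> ~ eventually_periodic x ->
  (forall i n, exists j, window x i n = window w j n) ->
  forall i n, exists j, window w i n = window x j n.
Proof.
move=> st aper sub i n; have [P szP uP] := aperiodic_complexity n aper.
have [l [ul [szl lP]]] := st n.
have [||_ E] := @uniq_min_size _ [seq window x k n | k <- P] l uP.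
- move=> v /mapP[k _ ->]; apply/lP; rewrite size_mkseq; split=> //.
  by have [j ->] := sub k n; apply: factor_window.
- by rewrite szl size_map szP.
have : window w i n \in l by apply/lP; rewrite size_mkseq; split=> //; apply: factor_window.
by rewrite -E => /mapP[j _ ->]; exists j.
Qed.

(** * Balance *)

Definition balanced (x : word) : Prop :=
  forall n i j, ones x i n <= ones x j n + 1.

(* b z b occurs at i and c z c at j with b != c and z a palindrome, and b z is
   always followed by b. Then c z does not occur in the m+2 windows that follow
   i, because the letter of z mirrored in the occurrence would have to be both
   b and c; so none of these windows is right special. *)
Lemma unbalanced_periodic w m i j :
  sturmian w -> w i <> w j -> w (i + m.+1) = w i -> w (j + m.+1) = w j ->
  (forall k, k < m -> w (i + k.+1) = w (j + k.+1)) ->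
  (forall k, k < m -> w (i + k.+1) = w (i + (m - k))) ->
  (forall a, window w a m.+1 = window w i m.+1 -> w (a + m.+1) = w i) ->
  eventually_periodic w.
Proof.
move=> st nij wi wj Ez pal follow.
have [l [ul [szl lP]]] := st m.+1.
have inl k : window w k m.+1 \in l.
  by apply/lP; rewrite size_mkseq; split=> //; apply: factor_window.
have special_z : special_pair w m i.+1 j.+1.
  split; first by apply/windowP => k /Ez; rewrite !addSnnS.
  by rewrite !addSnnS wi wj.
have avoid t : t <= m.+1 -> window w (i + t) m.+1 <> window w j m.+1.
  move=> le_t /windowP E; have := E 0 isT; rewrite !addn0 => Et.
  case: t le_t E Et => [|t] le_t E Et; first by rewrite addn0 in Et.
  have [lt_t | ge_t] := ltnP t m; last first.
    by apply: nij; rewrite -Et; have -> : t = m by lia.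
  have := E (m - t); rewrite -addnA ltnS leq_subr => /(_ isT).
  have -> : t.+1 + (m - t) = m.+1 by lia.
  rewrite wi; have -> : m - t = (m - t).-1.+1 by lia.
  rewrite -Ez; last by lia.
  rewrite pal; last by lia.
  have -> : m - (m - t).-1 = t.+1 by lia.
  by rewrite Et.
(* Without the window at [j], only [m + 1] factors remain for the [m + 2] windows that start at [i],
   ..., [i + m + 1]. *)
have [t le_t | t [q [q_gt0 le_tq E]]] := @window_pigeonhole w m.+1 i (rem (window w j m.+1) l).
  rewrite mem_rem_uniq // inE /= inl andbT; apply/eqP/avoid.
  by move: le_t; rewrite size_rem // szl /= => /leq_trans -> .
apply: (deterministic_periodic q_gt0 E) => u a lt_u Ea.
apply: contrapT => neq; set b := i + t + u in Ea neq.
have le_tu : t + u <= m.+1 by move: le_tq; rewrite size_rem // szl /=; lia.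
(* The window at [b] is right special, so its last [m] letters are z. By its first letter it is then
   the window at [i], excluded by [follow], or the one at [j], excluded by [avoid]. *)
have Eb1 : window w b.+1 m = window w i.+1 m.
  apply: (@special_unique w m b.+1 a.+1 i.+1 j.+1 st) special_z.
  split; last by rewrite !addSnnS => /esym.
  apply/windowP => k lt_km; rewrite !addSnnS.
  by move/windowP: Ea => ->.
have Eb c : w b = w c -> window w i.+1 m = window w c.+1 m -> window w b m.+1 = window w c m.+1.
  move=> E0 /windowP E1; apply/windowP => -[_|k lt_km]; first by rewrite !addn0.
  by rewrite -!addSnnS -E1 //; move/windowP: Eb1 => ->.
have [bi | bi] := eqVneq (w b) (w i).
  by have Ebi := Eb i bi erefl; apply: neq; rewrite !follow // Ea.
apply: (avoid (t + u) le_tu); rewrite addnA; apply: Eb special_z.1.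
by case: (w b) (w i) (w j) bi nij => [] [] [].
Qed.

(* An unbalanced pair of minimal length reads 1 z 1 and 0 z 0, and z is a
   palindrome because a mismatch with its mirror image would give a shorter
   unbalanced pair. One of 1 z 0 and 0 z 1 is not a factor, as otherwise 0 z and
   1 z would both be right special. *)
Lemma sturmian_balanced w : sturmian w -> balanced w.
Proof.
move=> st n; elim/ltn_ind: n => n IHn i j; rewrite leqNgt; apply/negP => big.
have aper := sturmian_aperiodic st.
(* The total excess is at least 2, and by minimality it is at most 1 on the first [k] letters and on
   the rest, so it is exactly 1 on both. *)
have pre k : 0 < k < n -> ones w i k = ones w j k + 1.
  move=> /andP[k_gt0 lt_kn].
  have := ones_add w i k (n - k); have := ones_add w j k (n - k).
  rewrite subnKC ?(ltnW lt_kn) // => Ej Ei.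
  have := IHn k lt_kn i j; have := IHn (n - k) _ (i + k) (j + k).
  by rewrite ltn_subrL k_gt0; lia.
have n_gt1 : 1 < n.
  case: n {IHn pre} big => [|[|]] //; first by rewrite /ones !big_ord0.
  by rewrite !ones1; case: (w i); case: (w j).
case: n n_gt1 IHn big pre => [|[|m]] // _ IHn big pre.
have [wi wj] : w i = true /\ w j = false.
  by have := pre 1 isT; rewrite !ones1; case: (w i); case: (w j).
have snoc x a k : ones x a k.+1 = ones x a k + x (a + k).
  by rewrite -addn1 ones_add ones1.
have cons x a k : ones x a k.+1 = x a + ones x a.+1 k.
  by rewrite -add1n ones_add ones1 addn1.
have [wi' wj'] : w (i + m.+1) = true /\ w (j + m.+1) = false.
  move: big; rewrite [ones w i _]snoc [ones w j _]snoc pre ?ltnSn //.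
  by case: (w (i + _)); case: (w (j + _)); rewrite ?addn0 ?addn1; lia.
have Ez k : k < m -> w (i + k.+1) = w (j + k.+1).
  move=> lt_km; have := pre k.+1; have := pre k.+2.
  rewrite (snoc w i k.+1) (snoc w j k.+1) !ltnS lt_km ltnW //=.
  move=> /(_ isT) E2 /(_ (ltnW lt_km)) E1; move: E2; rewrite E1.
  by case: (w (i + _)); case: (w (j + _)); lia.
have pal k : k < m -> w (i + k.+1) = w (i + (m - k)).
  elim/ltn_ind: k => k IHk lt_km.
  have mid : ones w i.+1 k = ones w (i + (m - k)).+1 k.
    rewrite [RHS](reindex_inj rev_ord_inj); apply: eq_bigr => u _ /=.
    have lt_u := ltn_ord u.
    have -> : (i + (m - k)).+1 + (k - u.+1) = i + (m - u) by lia.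
    by rewrite addSnnS IHk //; lia.
  have midj : ones w j.+1 k = ones w (j + (m - k)).+1 k.
    transitivity (ones w i.+1 k).
      by apply: eq_ones => v lt_v; rewrite !addSnnS Ez //; lia.
    rewrite mid; apply: eq_ones => v lt_v.
    have -> : (i + (m - k)).+1 + v = i + (m - k + v).+1 by lia.
    by rewrite Ez; [congr w|]; lia.
  have Ek1 : (i + (m - k)).+1 + k = i + m.+1 by lia.
  have Ek2 : (j + (m - k)).+1 + k = j + m.+1 by lia.
  have Emk : w (i + (m - k)) = w (j + (m - k)).
    by have := Ez (m - k).-1; rewrite prednK ?subn_gt0 //; apply; lia.
  (* If the mirrored letters differ, one of these two shorter pairs, each made of an end of 1 z 1
     and the opposite end of 0 z 0, is unbalanced. *)
  have := IHn k.+2 _ i (j + (m - k)); have := IHn k.+2 _ (i + (m - k)) j.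
  rewrite !(cons _ _ k.+1) !(snoc _ _ k) Ek1 Ek2 -mid -midj !addSnnS wi wj wi' wj' -Ez // -Emk.
  have -> : ones w j.+1 k = ones w i.+1 k.
    by apply: eq_ones => v lt_v; rewrite !addSnnS Ez //; lia.
  by rewrite !ltnS lt_km; case: (w (i + k.+1)); case: (w (i + (m - k))); lia.
have [follow | not_follow] := pselect (forall a,
    window w a m.+1 = window w i m.+1 -> w (a + m.+1) = w i).
  by apply: aper; apply: (unbalanced_periodic st _ _ _ Ez pal follow); rewrite ?wi ?wj.
apply: aper; apply: (@unbalanced_periodic w m j i st); rewrite ?wi ?wj //.
- by move=> k /Ez.
- move=> k lt_km; rewrite -Ez // pal //.
  by have := Ez (m - k).-1; rewrite prednK ?subn_gt0 //; apply; lia.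
move=> a Ea; apply: contrapT => wa; apply: not_follow => b Eb; rewrite wi.
apply: contrapT => wb.
have : window w j m.+1 = window w i m.+1.
  apply: (@special_unique w _ j a i b) => //.
    by split=> //; rewrite wj'; move: wa; case: (w _).
  by split=> //; rewrite wi'; move: wb; case: (w _).
by move=> /windowP/(_ 0 isT); rewrite !addn0 wi wj.
Qed.

(* If x has period q with a ones per period, then all factors of w of length q k
   have between a k - 1 and a k + 1 ones. By balance the factors of length q
   deviate from a on one side only, so at most one of them does in each residue
   class of positions modulo q. *)
Lemma balanced_eventually_periodic w x :
  balanced w -> (forall i n, exists j, window x i n = window w j n) ->
  eventually_periodic x -> eventually_periodic w.
Proof.
move=> bal sub [q [N [q_gt0 per]]]; pose a := ones x N q.
have xN k : ones x N (q * k) = a * k.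
  elim: k => [|k IHk]; first by rewrite !muln0 /ones big_ord0.
  rewrite mulnS addnC ones_add IHk mulnS addnC; congr addn.
  apply: eq_ones => u _; elim: k {IHk} => [|k IHk]; first by rewrite muln0 addn0.
  by rewrite -IHk -[RHS]per ?mulnS; [congr x|]; lia.
have close i k : ones w i (q * k) <= a * k + 1 /\ a * k <= ones w i (q * k) + 1.
  rewrite -xN; have [j /windowP xw] := sub N (q * k).
  by rewrite (eq_ones xw); split; apply: bal.
have blocks_ge i k : (forall j, a <= ones w j q) -> a * k <= ones w i (q * k).
  move=> ge_a; elim: k i => [|k IHk] i; first by rewrite !muln0.
  by rewrite !mulnS ones_add leq_add.
have blocks_le i k : (forall j, ones w j q <= a) -> ones w i (q * k) <= a * k.
  move=> le_a; elim: k i => [|k IHk] i; first by rewrite !muln0 /ones big_ord0.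
  by rewrite !mulnS ones_add leq_add.
have split3 i k : ones w i (q * k.+2) =
    ones w i q + ones w (i + q) (q * k) + ones w (i + q + q * k) q.
  have -> : q * k.+2 = q + q * k + q by rewrite !mulnS; lia.
  by rewrite !ones_add addnA.
have tail r : exists M, forall k, M <= k -> ones w (r + q * k) q = a.
  apply: contrapT => /forallNP often.
  have next M : exists2 k, M <= k & ones w (r + q * k) q <> a.
    by have /existsNP[k /not_implyP[? ?]] := often M; exists k.
  have [k1 _ neq1] := next 0; have [k2 lt_k neq2] := next k1.+1.
  have := split3 (r + q * k1) (k2 - k1.+1).
  have -> : r + q * k1 + q + q * (k2 - k1.+1) = r + q * k2.
    by rewrite -{2}(subnKC lt_k) mulnDr mulnS; lia.
  have [le_s ge_s] := close (r + q * k1) (k2 - k1.+1).+2.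
  have same_side j : ones w (r + q * k1) q <= ones w j q + 1 /\
                     ones w j q <= ones w (r + q * k1) q + 1 by split; apply: bal.
  have [c1 c2] := same_side (r + q * k2).
  have near j : ones w j q <= a + 1 /\ a <= ones w j q + 1.
    by have := close j 1; rewrite !muln1.
  have [n1 n1'] := near (r + q * k1); have [n2 n2'] := near (r + q * k2).
  (* If the first block exceeds [a], no block falls below [a]; the two end blocks then push the
     total at least 2 above the mean, against [close]. The other case is symmetric. *)
  have [gt_a | le_a] := ltnP a (ones w (r + q * k1) q).
    have ge_a j : a <= ones w j q by have := same_side j; lia.
    have := blocks_ge (r + q * k1 + q) (k2 - k1.+1) ge_a.
    by have := ge_a (r + q * k2); rewrite !mulnS in le_s ge_s *; lia.
  have le_a' j : ones w j q <= a by have := same_side j; lia.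
  have := blocks_le (r + q * k1 + q) (k2 - k1.+1) le_a'.
  by have := le_a' (r + q * k2); rewrite !mulnS in le_s ge_s *; lia.
have [f fP] := choice tail; pose M := \max_(r < q) f r.
have const i : q * M <= i -> ones w i q = a.
  move=> le_i; rewrite (divn_eq i q) addnC mulnC; apply: fP.
  apply: leq_trans (@leq_bigmax _ (fun r : 'I_q => f r) (Ordinal (ltn_pmod i q_gt0))) _.
  by rewrite leq_divRL // mulnC.
(* The windows of length [q] at [i] and [i + 1] have equally many ones, so the letter left behind
   equals the letter gained. *)
exists q, (q * M); split=> // i le_i.
have := ones_add w i q 1; have := ones_add w i 1 q.
rewrite addnC => ->; rewrite !ones1 addn1 !const ?(leqW le_i) //.
by case: (w i) (w (i + q)) => [] []; lia.
Qed.

(** * Limits along idempotents *)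

Section Ultrafilter.
Variable p : ufilter.
Hypothesis up : is_ultrafilter p.

Lemma ultraT : p (fun _ => True). Proof. by case: up. Qed.

Lemma ultraS (A B : nat -> Prop) : (forall n, A n -> B n) -> p A -> p B.
Proof. by case: up => _ [_ [_ [pS _]]]; apply: pS. Qed.

Lemma ultraI A B : p A -> p B -> p (fun n => A n /\ B n).
Proof. by case: up => _ [_ [pI _]]; apply: pI. Qed.

Lemma ultraC A : p (fun n => ~ A n) <-> ~ p A.
Proof.
case: up => _ [p0 [_ [_ pC]]]; split=> [nA pA | nA]; last by case: (pC A).
by apply: p0; apply: ultraS (ultraI pA nA) => n [].
Qed.

Lemma ultra_ex A : p A -> exists n, A n.
Proof.
move=> pA; apply: contrapT => /forallNP nA; case: up => _ [p0 _].
by apply: p0; apply: ultraS pA => n /nA.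
Qed.

Lemma ultra_bounded (A : nat -> nat -> Prop) L :
  (forall k, k < L -> p (A k)) -> p (fun n => forall k, k < L -> A k n).
Proof.
elim: L => [|L IHL] pA; first by apply: ultraS ultraT.
have pL := IHL (fun k lt_k => pA k (ltnW lt_k)).
apply: ultraS (ultraI pL (pA L (ltnSn L))) => n [H HL] k.
by rewrite ltnS leq_eqVlt => /predU1P[-> | /H].
Qed.

Lemma nonprincipal_ge M : ~ principal p -> p (fun n => M <= n).
Proof.
move=> np; elim: M => [|M IHM]; first by apply: ultraS ultraT.
apply: contrapT => /ultraC nM; apply: np; exists M => A.
have pM : p (fun n => n = M).
  apply: ultraS (ultraI IHM nM) => n [? /negP]; rewrite -leqNgt => ?.
  by apply: anti_leq; apply/andP.
split=> [pA | AM]; last by apply: ultraS pM => n ->.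
by have [n [An <-]] := ultra_ex (ultraI pA pM).
Qed.

End Ultrafilter.

Section Limit.
Variables (w : word) (p : ufilter).
Hypothesis ip : Defs.idempotent p.

Let up : is_ultrafilter p := ip.1.

Definition limit_word : word := fun k => `[< p (fun n => w (n + k)) >].

Let y := limit_word.

Lemma limit_prefix L : p (fun n => forall k, k < L -> w (n + k) = y k).
Proof.
apply: ultra_bounded => // k _; rewrite /y /limit_word.
case: asboolP => [|npk]; first by apply: ultraS.
by apply: ultraS (iffRL (ultraC up _) npk) => // n /negP/negbTE.
Qed.

(** Since p + p = p, the limit of w(n + k) along [p] is the iterated limit of w(m + n + k), first in
    m and then in n; the inner limit is y(n + k). *)
Lemma limit_recurrent L : p (fun n => forall k, k < L -> y (n + k) = y k).
Proof.
apply: ultra_bounded => // k _.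
have y_shift n : y (n + k) = `[< p (shiftset (fun m => w (m + k)) n) >].
  by congr asbool; congr p; apply: funext => m; rewrite /shiftset addnA.
have pk : p (fun m => w (m + k)) = p (fun n => p (shiftset (fun m => w (m + k)) n)).
  by rewrite -[in LHS]ip.2.2.
have -> : y k = `[< p (fun n => p (shiftset (fun m => w (m + k)) n)) >] by rewrite -pk.
case: asboolP => [|npk].
  by apply: ultraS => // n pn; rewrite y_shift; apply/asboolP.
apply: ultraS (iffRL (ultraC up _) npk) => // n pn.
by rewrite y_shift; apply: asboolF.
Qed.

Lemma limit_factor i n : exists j, window y i n = window w j n.
Proof.
have [m wy] := ultra_ex up (limit_prefix (i + n)).
by exists (m + i); apply/windowP => k lt_k; rewrite -addnA wy // ltn_add2l.
Qed.

End Limit.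

Lemma limit_aperiodic w p :
  sturmian w -> Defs.idempotent p -> ~ eventually_periodic (limit_word w p).
Proof.
move=> st ip per; apply: (sturmian_aperiodic st).
by apply: balanced_eventually_periodic per; [apply: sturmian_balanced | apply: limit_factor].
Qed.

(** * Discrepancy between a Sturmian word and its limit *)

Section Difference.
Variables (w : word) (p : ufilter).
Hypotheses (st : sturmian w) (ip : Defs.idempotent p).

Let up : is_ultrafilter p := ip.1.
Let np : ~ principal p := ip.2.1.
Let y := limit_word w p.

Let bal_ww : forall n i j, ones w i n <= ones w j n + 1 := sturmian_balanced st.

Let bal_yw n i j : ones y i n <= ones w j n + 1.
Proof. by have [k /windowP yw] := limit_factor w ip i n; rewrite (eq_ones yw) bal_ww. Qed.

Let bal_wy n i j : ones w i n <= ones y j n + 1.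
Proof. by have [k /windowP yw] := limit_factor w ip j n; rewrite (eq_ones yw) bal_ww. Qed.

(* The discrepancy D(m) = |w[0,m)|_1 - |y[0,m)|_1 is shifted by 1 so that d is a
   natural number. *)
Lemma ultra_discrepancy :
  exists d, p (fun n => ones w 0 n + 1 = ones y 0 n + d).
Proof.
apply: contrapT => /forallNP nd.
have nd' d := iffRL (ultraC up _) (nd d).
(* Balance leaves only the values 0, 1 and 2 for the shifted discrepancy. *)
have [n [[n0 n1] n2]] := ultra_ex up (ultraI up (ultraI up (nd' 0) (nd' 1)) (nd' 2)).
by have := bal_wy n 0 0; have := bal_yw n 0 0; lia.
Qed.

(** Count the ones among the first [m + n] letters of [w], cutting once at [m] and once at [n]; for
    [p]-many [n] the [m] letters from [n] on are those of a prefix of [y]. *)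
Lemma ultra_ones_w d m : p (fun n => ones w 0 n + 1 = ones y 0 n + d) ->
  p (fun n => ones w m n + (ones w 0 m + 1) = ones y 0 n + (ones y 0 m + d)).
Proof.
move=> pd; apply: ultraS (ultraI up pd (limit_prefix w ip m)) => // n [dn wy].
have Enm : ones w n m = ones y 0 m by apply: eq_ones => k /wy.
have := ones_add w 0 m n; have := ones_add w 0 n m.
by rewrite (addnC n m) !add0n; lia.
Qed.

Lemma ultra_ones_limit m : p (fun n => ones y m n = ones y 0 n).
Proof.
apply: ultraS (limit_recurrent w ip m) => // n yy.
have Enm : ones y n m = ones y 0 m by apply: eq_ones => k /yy.
have := ones_add y 0 m n; have := ones_add y 0 n m.
by rewrite (addnC n m) !add0n; lia.
Qed.

Lemma discrepancy_lex d i j k :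
  p (fun n => ones w 0 n + 1 = ones y 0 n + d) ->
  ones w 0 i + 1 <> ones y 0 i + d -> ones w 0 j + 1 <> ones y 0 j + d ->
  window w i k = window w j k -> w (i + k) = false -> w (j + k) = true -> False.
Proof.
move=> pd di dj Ek wi wj.
have [li Eli] := aperiodic_same_factors st (limit_aperiodic st ip) (limit_factor w ip) i k.+1.
have [lj Elj] := aperiodic_same_factors st (limit_aperiodic st ip) (limit_factor w ip) j k.+1.
(* Let Y be [ones y 0 n]. By balance the factors of [w] of length [n] at [i] and [j] have Y + a ones
   with the same a = 1 or a = -1, while those of [y] at [li] and [lj] have Y. Past the first [k + 1]
   letters, [w] at [i] exceeds [y] at [lj] by a + 1, and [w] at [j] exceeds [y] at [li] by a - 1;
   balance would force a = 0. *)
have [n [[[[lt_kn wni] wnj] yni] ynj]] := ultra_ex up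
  (ultraI up (ultraI up (ultraI up (ultraI up (nonprincipal_ge up k.+1 np)
   (ultra_ones_w i pd)) (ultra_ones_w j pd)) (ultra_ones_limit li)) (ultra_ones_limit lj)).
have Oi : ones y li k.+1 = ones w i k.+1 by apply: eq_ones => u; move/windowP: Eli => E /E.
have Oj : ones y lj k.+1 = ones w j k.+1 by apply: eq_ones => u; move/windowP: Elj => E /E.
have Ok : ones w i k = ones w j k by apply: eq_ones; apply/windowP.
have snoc a : ones w a k.+1 = ones w a k + w (a + k) by rewrite -addn1 ones_add ones1.
rewrite !snoc wi in Oi; rewrite snoc wj in Oj.
have split x a : ones x a n = ones x a k.+1 + ones x (a + k.+1) (n - k.+1).
  by rewrite -ones_add subnKC.
have := split w i; have := split w j; have := split y li; have := split y lj.
rewrite !snoc wi wj.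
have := bal_yw (n - k.+1) (li + k.+1) (j + k.+1).
have := bal_wy (n - k.+1) (i + k.+1) (lj + k.+1).
have := bal_ww n i j; have := bal_ww n j i.
have := bal_yw n 0 i; have := bal_wy n i 0; have := bal_yw n 0 j; have := bal_wy n j 0.
lia.
Qed.

Lemma discrepancy_unique d i j :
  p (fun n => ones w 0 n + 1 = ones y 0 n + d) ->
  ones w 0 i + 1 <> ones y 0 i + d -> ones w 0 j + 1 <> ones y 0 j + d -> i = j.
Proof.
move=> pd; wlog lt_ij : i j / i < j => [W di dj|di dj].
  by case: (ltngtP i j) => // lt_ij; [apply: W | apply/esym; apply: W].
(* Otherwise [w] would have period [j - i] from [i] on. *)
have exk : exists k, w (i + k) != w (j + k).
  apply: contrapT => /forallNP same; apply: (sturmian_aperiodic st).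
  exists (j - i), i; split=> [|m le_m]; first by rewrite subn_gt0.
  have /negP/negPn/eqP := same (m - i).
  by rewrite subnKC // => ->; congr w; lia.
have [k neq_k min_k] := ex_minnP exk.
have Ek : window w i k = window w j k.
  apply/windowP => u lt_u; apply/eqP; apply: contraLR lt_u => /min_k.
  by rewrite -leqNgt.
case wi: (w (i + k)) neq_k; case wj: (w (j + k)) => // _.
  by case: (discrepancy_lex pd dj di (esym Ek) wj wi).
by case: (discrepancy_lex pd di dj Ek wi wj).
Qed.

Lemma eventually_limit : exists M, forall m, M <= m -> w m = y m.
Proof.
have [d pd] := ultra_discrepancy.
have [M dM] : exists M, forall m, M <= m -> ones w 0 m + 1 = ones y 0 m + d.
  have [[i di] | /forallNP none] := pselect (exists i, ones w 0 i + 1 <> ones y 0 i + d).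
    exists i.+1 => m lt_im; apply: contrapT => dm.
    by move: lt_im; rewrite (discrepancy_unique pd di dm) ltnn.
  by exists 0 => m _; apply: contrapT (none m).
exists M => m le_m; have := dM _ le_m; have := dM _ (leqW le_m).
rewrite -addn1 !ones_add !ones1 add0n.
by case: (w m) (y m) => [] []; lia.
Qed.

Lemma limit_nonsingular : nonsingular w -> w = y.
Proof.
move=> ns; have [M wy] := eventually_limit.
apply: funext => m; apply: contrapT => neq_m; apply: ns.
have exd : exists t, w t != y t by exists m; apply/eqP.
have bnd t : w t != y t -> t <= M.
  by apply: contraR; rewrite -ltnNge => /ltnW/wy ->.
have [t neq_t max_t] := ex_maxnP exd bnd.
have tail k : w (t.+1 + k) = y (t.+1 + k).
  apply/eqP; rewrite -[_ == _]negbK; apply/negP => /max_t.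
  by rewrite leqNgt ltnS leq_addr.
(* At [t] the words [w] and [y] show different letters before the same tail, and the factors of [y]
   are factors of [w]. *)
have ext x k : x = w \/ x = y -> window x t k.+1 = x t :: mkseq (shiftn t.+1 w) k.
  move=> xwy; rewrite /window /mkseq /= addn0 -[1]addn0 iotaDl -map_comp.
  congr cons; apply: eq_map => u /=; rewrite add1n -addSnnS.
  by rewrite /shiftn; case: xwy => ->; rewrite ?tail.
exists t.+1; split=> //; split=> k.
  exact: (factor_window w t.+1 k).
have Ew := ext w k (or_introl erefl); have Ey := ext y k (or_intror erefl).
have [j Ej] := limit_factor w ip t k.+1.
have Fw := factor_window w t k.+1; have Fy := factor_window w j k.+1.
rewrite Ew in Fw; rewrite -Ej Ey in Fy; move: neq_t Fw Fy.
by case: (w t) (y t) => [] [] // _ ? ?; split.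
Qed.

End Difference.

Lemma prefix_in_idempotent w p L :
  sturmian w -> nonsingular w -> Defs.idempotent p ->
  p (fun n => window w n L = window w 0 L).
Proof.
move=> st ns ip; have E := limit_nonsingular st ip ns.
apply: ultraS (limit_prefix w ip L) => //; first by case: ip.
by move=> n wy; apply/windowP => k /wy ->; rewrite -E.
Qed.

(** * Idempotents in the semigroup of ultrafilters *)

Definition is_filter (F : ufilter) : Prop :=
  [/\ F (fun _ => True), ~ F (fun _ => False),
      forall A B, F A -> F B -> F (fun n => A n /\ B n)
    & forall A B : nat -> Prop, (forall n, A n -> B n) -> F A -> F B].

(* A filter F stands for the closed set of the ultrafilters that contain it; then
   uadd p F stands for the translate p + F. *)
Definition contains (F p : ufilter) : Prop := forall A, F A -> p A.

Lemma ultra_filter p : is_ultrafilter p -> is_filter p.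
Proof. by case=> ? [? [? [? _]]]. Qed.

Lemma filter_ultra F : is_filter F -> exists2 p, is_ultrafilter p & contains F p.
Proof.
move=> [FT F0 FI FS].
have FF : ProperFilter F.
  by split=> //; split.
have [p [pU Fp]] := ultraFilterLemma FF; exists p; last exact: Fp.
split; first exact: filterT.
split; first exact: filter_not_empty.
split; first by move=> A B; apply: filterI.
by split=> [A B AB | A]; [apply: filterS | apply: in_ultra_setVsetC].
Qed.

Lemma ultra_eq p q : is_ultrafilter p -> is_ultrafilter q -> contains p q -> p = q.
Proof.
move=> pu qu pq; apply/predeqP => A; split; first exact: pq.
by move=> qA; apply: contrapT => /(ultraC pu)/pq/(ultraC qu).
Qed.

Lemma filter_from_ultra F A : is_filter F ->
  (forall p, is_ultrafilter p -> contains F p -> p A) -> F A.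
Proof.
move=> [FT F0 FI FS] allp; apply: contrapT => nA.
(* This is the filter generated by [F] and the complement of [A], proper because [A] is not in
   [F]. *)
have [|p pu Gp] := @filter_ultra (fun B => F (fun n => A n \/ B n)).
  split=> [||B C FB FC|B C BC]; first by apply: FS FT; right.
  - by move=> FA; apply: nA; apply: FS FA => n [].
  - by apply: FS (FI _ _ FB FC) => n; tauto.
  - by apply: FS => n [|/BC]; [left | right].
have : p (fun n => ~ A n) by apply: Gp; apply: FS FT => n _; apply: EM.
move=> /(ultraC pu); apply; apply: allp => // B FB; apply: Gp.
by apply: FS FB; right.
Qed.

Lemma shiftset_add A m n : shiftset (shiftset A n) m = shiftset A (m + n).
Proof. by apply: funext => k; rewrite /shiftset addnA. Qed.

Lemma uaddA p q r : uadd (uadd p q) r = uadd p (uadd q r).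
Proof.
apply: funext => A; rewrite /uadd; congr r; apply: funext => n; congr q.
by apply: funext => m; rewrite shiftset_add.
Qed.

Lemma uadd_filter F p : is_filter F -> is_filter p -> is_filter (uadd p F).
Proof.
move=> [FT F0 FI FS] [pT p0 pI pS]; split.
- by apply: FS FT.
- by apply: contra_not F0; apply: FS.
- by move=> A B FA FB; apply: FS (FI _ _ FA FB) => n []; apply: pI.
- by move=> A B AB; apply: FS => n; apply: pS => m; apply: AB.
Qed.

Lemma uadd_ultra p q : is_ultrafilter p -> is_ultrafilter q -> is_ultrafilter (uadd p q).
Proof.
move=> pu qu; have [T0 N0 I0 S0] := uadd_filter (ultra_filter qu) (ultra_filter pu).
do 4!split => //; move=> A; have [pA | /(ultraC qu) npA] := pselect (uadd p q A); [by left|right].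
by apply: ultraS npA => // n /(ultraC pu).
Qed.

(* The filter of the closed set of those q in F with p + q = r. *)
Definition fiber_filter (p F r : ufilter) : ufilter :=
  fun B => exists A C, [/\ F C, r A & forall n, C n -> p (shiftset A n) -> B n].

(** For properness: if the fiber were empty, the complement of some [A] in [r] would belong to
    [uadd p F], hence to [r]. *)
Lemma fiber_filterP p F r :
  is_ultrafilter p -> is_filter F -> is_ultrafilter r -> contains (uadd p F) r ->
  is_filter (fiber_filter p F r).
Proof.
move=> pu [FT F0 FI FS] ru Fr; split.
- by exists (fun _ => True), (fun _ => True); split=> //; apply: ultraT.
- move=> [A [C [FC rA CA]]].
  have : r (fun n => ~ A n) by apply/Fr/(FS _ _ _ FC) => n /CA/(ultraC pu).
  by move/(ultraC ru).
- move=> B1 B2 [A1 [C1 [FC1 rA1 CA1]]] [A2 [C2 [FC2 rA2 CA2]]].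
  exists (fun n => A1 n /\ A2 n), (fun n => C1 n /\ C2 n).
  split; [exact: FI | exact: ultraI | move=> n [c1 c2] pA].
  by split; [apply: CA1 | apply: CA2] => //; apply: ultraS pA => // m [].
- by move=> B1 B2 B12 [A [C [FC rA CA]]]; exists A, C; split=> // n /CA CB /CB; apply: B12.
Qed.

Lemma fiber_filter_base p F r : is_ultrafilter r -> contains F (fiber_filter p F r).
Proof. by move=> ru C FC; exists (fun _ => True), C; split=> //; apply: ultraT. Qed.

Lemma fiber_filter_uadd p F r q :
  is_ultrafilter p -> is_filter F -> is_ultrafilter r -> is_ultrafilter q ->
  contains (fiber_filter p F r) q -> r = uadd p q.
Proof.
move=> pu [FT _ _ _] ru qu Gq; apply: ultra_eq => //; first exact: uadd_ultra.
by move=> A rA; apply: Gq; exists A, (fun _ => True).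
Qed.

(** Left translation by [p] is continuous on a compact space, so it maps the closed set of [F] onto
    a closed set, the one of [uadd p F]. *)
Lemma uadd_surj p F r :
  is_ultrafilter p -> is_filter F -> is_ultrafilter r -> contains (uadd p F) r ->
  exists q, [/\ is_ultrafilter q, contains F q & r = uadd p q].
Proof.
move=> pu Ff ru Fr; have [q qu Gq] := filter_ultra (fiber_filterP pu Ff ru Fr).
exists q; split=> //; last exact: (fiber_filter_uadd pu Ff ru qu Gq).
by move=> A /(@fiber_filter_base p F r ru)/Gq.
Qed.

Lemma maximal_filter (Q : ufilter -> Prop) (F0 : ufilter) :
  Q F0 ->
  (forall C : set ufilter, (exists X, C X) -> (C `<=` Q)%classic -> total_on C contains ->
     Q (\bigcup_(X in C) X)%classic) ->
  exists F, [/\ contains F0 F, Q F & forall G, Q G -> contains F G -> contains G F].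
Proof.
move=> Q0 Qchain.
(* [Zorn_bigcup] also asks about the empty chain, whose union may fail [Q]; with [F0] added to every
   set, that chain yields [F0]. *)
have [|A [QA maxA]] := @Zorn_bigcup _ (fun X : set (nat -> Prop) => Q (F0 `|` X)%classic).
  move=> C CQ Ctot; have [[X0 CX0] | C0] := pselect ((exists X, C X)); last first.
    suff -> : (\bigcup_(X in C) X = set0)%classic by rewrite setU0.
    by rewrite -subset0 => A [X CX _]; apply: C0; exists X.
  have -> : (F0 `|` \bigcup_(X in C) X = \bigcup_(Y in [set F0 `|` X | X in C]) Y)%classic.
    apply/seteqP; split=> [A [F0A | [X CX XA]] | A [_ [X CX <-]] [F0A | XA]].
    - by exists (F0 `|` X0)%classic; [exists X0 | left].
    - by exists (F0 `|` X)%classic; [exists X | right].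
    - by left.
    - by right; exists X.
  apply: Qchain; first by exists (F0 `|` X0)%classic; exists X0.
    by move=> _ [X CX <-]; apply: CQ.
  move=> _ _ [X CX <-] [Y CY <-].
  have [XY | YX] := Ctot X Y CX CY; [left | right] => A [?|?].
  - by left.
  - by right; apply: XY.
  - by left.
  - by right; apply: YX.
exists (F0 `|` A)%classic; split=> // [B | G QG FG]; first by left.
apply: contrapT => nGF; apply: (maxA G); last first.
  suff -> : (F0 `|` G)%classic = G by [].
  by apply/setUidPr => B ?; apply: FG; left.
split=> [B ? | GA]; first by apply: FG; right.
by apply: nGF => B /GA; right.
Qed.

Lemma bigcup_filter (C : set ufilter) :
  (exists X, C X) -> (C `<=` is_filter)%classic -> total_on C contains ->
  is_filter (\bigcup_(X in C) X)%classic.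
Proof.
move=> [X0 CX0] CF Ctot; split.
- by exists X0 => //; case: (CF _ CX0).
- by move=> [X CX]; case: (CF _ CX).
- move=> A B [X CX XA] [Y CY YB].
  have [XY | YX] := Ctot X Y CX CY.
    by exists Y => //; case: (CF _ CY) => _ _ YI _; apply: YI => //; apply: XY.
  by exists X => //; case: (CF _ CX) => _ _ XI _; apply: XI => //; apply: YX.
- by move=> A B AB [X CX XA]; exists X => //; case: (CF _ CX) => _ _ _ XS; apply: XS XA.
Qed.

Definition semigroup_filter (F : ufilter) : Prop :=
  is_filter F /\
  forall p q, is_ultrafilter p -> is_ultrafilter q -> contains F p -> contains F q ->
    contains F (uadd p q).

(* Shift-invariant filters are the closed right ideals. *)
Definition shift_invariant (F : ufilter) : Prop :=
  is_filter F /\ forall A n, F A -> F (shiftset A n).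

Lemma shift_invariant_semigroup F : shift_invariant F -> semigroup_filter F.
Proof.
move=> [Ff shF]; split=> // p q pu qu Fp Fq A FA.
by apply: ultraS (ultraT qu) => // n _; apply/Fp/shF.
Qed.

(* Ellis-Numakura: maximal filters are minimal closed subsemigroups S. For p in S,
   p + S and the set of q in S with p + q = p are closed subsemigroups of S. *)
Lemma maximal_semigroup_idempotent F p :
  semigroup_filter F ->
  (forall G, semigroup_filter G -> contains F G -> contains G F) ->
  is_ultrafilter p -> contains F p -> uadd p p = p.
Proof.
move=> [Ff FQ] maxF pu Fp.
have FpF : contains (uadd p F) F.
  apply: maxF => [|A FA].
    split=> [|r1 r2 r1u r2u].
      by apply: uadd_filter => //; apply: ultra_filter.
    move=> /(uadd_surj pu Ff r1u)[q1 [q1u Fq1 ->]].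
    move=> /(uadd_surj pu Ff r2u)[q2 [q2u Fq2 ->]] A FA.
    rewrite uaddA; apply: (FQ q1) FA => //; first exact: uadd_ultra.
    exact: FQ.
  by apply: (@filter_from_ultra F (fun n => p (shiftset A n))) => // q qu Fq; apply: (FQ p q) FA.
have pFp : contains (uadd p F) p by move=> A /FpF/Fp.
have Gf := fiber_filterP pu Ff pu pFp.
have GF : contains (fiber_filter p F p) F.
  apply: maxF; last exact: fiber_filter_base.
  split=> // s1 s2 s1u s2u Gs1 Gs2 B [A [C [FC pA CA]]].
  have Fs s : contains (fiber_filter p F p) s -> contains F s.
    by move=> Gs D /(fiber_filter_base p pu)/Gs.
  have su := uadd_ultra s1u s2u.
  have sC : uadd s1 s2 C by apply: FQ FC => //; apply: Fs.
  have sA : uadd p (uadd s1 s2) A.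
    rewrite -uaddA -(fiber_filter_uadd pu Ff pu s1u Gs1).
    by rewrite -(fiber_filter_uadd pu Ff pu s2u Gs2).
  by apply: (ultraS su) (ultraI su sC sA) => n []; apply: CA.
(* The fiber filter lies in [F], hence in [p], so [p] itself solves p + q = p. *)
by rewrite -(fiber_filter_uadd pu Ff pu pu (fun A GA => Fp A (GF A GA))).
Qed.

(** The final segments in [F] rule out principal solutions of p + p = p, such as the ultrafilter at
    0. *)
Lemma exists_idempotent F :
  semigroup_filter F -> (forall M, F (fun n => M <= n)) ->
  exists2 p, Defs.idempotent p & contains F p.
Proof.
move=> Fsg Fge.
have [||F' [FF' F'sg maxF']] := @maximal_filter semigroup_filter F.
- by [].
- move=> C C0 CQ Ctot; split; first by apply: bigcup_filter => // X /CQ[].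
  move=> p q pu qu Cp Cq A [X CX XA]; have [_ XQ] := CQ _ CX.
  by apply: XQ XA => // B XB; [apply: Cp | apply: Cq]; exists X.
have [p pu F'p] := filter_ultra F'sg.1.
exists p; last by move=> A /FF'/F'p.
split=> //; split; last exact: maximal_semigroup_idempotent F'p.
move=> [m pm]; have := F'p _ (FF' _ (Fge m.+1)).
by move/pm; rewrite ltnn.
Qed.

Lemma IPset_idempotent B : IPset B -> exists2 p, Defs.idempotent p & p B.
Proof.
move=> [x [x_incr xB]].
have x_ge i : i <= x i by elim: i => // i /leq_ltn_trans; apply.
(* The closed set of [F] is the intersection over [m] of the closures of the sets of finite sums of
   [x] with indices at least [m]. *)
pose F A := exists m, forall S : seq nat,
  uniq S -> S <> [::] -> all (leq m) S -> A (\sum_(i <- S) x i).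
have Ff : is_filter F.
  split=> [||A C [m mA] [l lC]|A C AC [m mA]]; first by exists 0.
  - by move=> [m /(_ [:: m])]; rewrite /= leqnn; apply.
  - exists (maxn m l) => S uS S0 /allP geS.
    by split; [apply: mA | apply: lC] => //; apply/allP => i /geS; rewrite geq_max => /andP[].
  - by exists m => S uS S0 geS; apply/AC/mA.
have Fsg : semigroup_filter F.
  split=> // p q pu qu Fp Fq A [m mA]; apply: Fq; exists m => S uS S0 /allP geS.
  (* The indices in [S'] lie beyond those in [S], so the two sums merge into one over a
     duplicate-free list. *)
  apply: Fp; exists (m + (\max_(i <- S) i).+1) => S' uS' S'0 /allP geS'.
  rewrite /shiftset -big_cat; apply: mA.
  - rewrite cat_uniq uS' uS andbT; apply/hasPn => i iS; apply/negP => /geS'.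
    have le_max : i <= \max_(j <- S) j by exact: (@leq_bigmax_seq _ S predT id i iS isT).
    by rewrite addnS ltnNge (leq_trans le_max) ?leq_addl.
  - by case: S' S'0 {geS' uS'}.
  - apply/allP => i; rewrite mem_cat => /orP[/geS' | /geS //].
    exact/leq_trans/leq_addr.
have [M|p ip Fp] := exists_idempotent Fsg.
  exists M => -[|i S] // _ _ /= /andP[Mi _]; rewrite big_cons.
  by rewrite (leq_trans Mi) // (leq_trans (x_ge i)) ?leq_addr.
by exists p => //; apply: Fp; exists 0 => S uS S0 _; apply: xB.
Qed.

(** A maximal shift-invariant filter stands for a minimal closed right ideal, and an idempotent in
    it lies in every two-sided ideal. Starting from the cofinite filter keeps the idempotent
    non-principal. *)
Lemma exists_minimal_idempotent : exists p, minimal_idempotent p.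
Proof.
have [||F [cofF [Ff shF] maxF]] :=
  @maximal_filter shift_invariant (fun A => exists M, forall n, M <= n -> A n).
- split=> [|A n [M MA]]; last first.
    by exists M => k leMk; apply: MA; rewrite (leq_trans leMk) ?leq_addr.
  split=> [||A B [M MA] [L LB]|A B AB [M MA]]; first by exists 0.
  + by move=> [M /(_ M (leqnn M))].
  + by exists (maxn M L) => n; rewrite geq_max => /andP[/MA ? /LB].
  + by exists M => n /MA/AB.
- move=> C C0 CQ Ctot; split; first by apply: bigcup_filter => // X /CQ[].
  by move=> A n [X CX XA]; exists X => //; apply: (CQ _ CX).2.
have [M | e ie Fe] := exists_idempotent (shift_invariant_semigroup (conj Ff shF)).
  by apply: cofF; exists M.
have eu := ie.1; exists e; split=> //; split=> // I [I_ultra [[s Is] I_ideal]].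
have su := I_ultra s Is; have [_ Ies] := I_ideal s e Is eu.
(* [allf] stands for the whole of beta N, so [uadd (uadd e s) allf] stands for the right ideal (e +
   s) + beta N. *)
pose allf : ufilter := fun A => forall n, A n.
have allff : is_filter allf.
  by split=> [//|/(_ 0)|A B ? ? n|A B AB allA n] //; apply/AB/allA.
have ru := uadd_ultra eu su.
(* e + s lies in I and generates the minimal right ideal F, which contains e. *)
have : contains (uadd (uadd e s) allf) F.
  apply: maxF => [|A FA n].
    split; first by apply: uadd_filter => //; apply: ultra_filter.
    by move=> A n Aall m; rewrite shiftset_add.
  by apply: (ultraS su) (ultraT su) => m _; rewrite shiftset_add; apply/Fe/shF.
move=> rF; have [|q [qu _ ->]] := uadd_surj ru allff eu; first by move=> A /rF/Fe.
by have [] := I_ideal (uadd e s) q Ies qu.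
Qed.

(** * Recurrent prefixes, IP-sets and the theorem *)

Lemma window_sub w i j m n k :
  window w i n = window w j n -> k + m <= n ->
  window w (i + k) m = window w (j + k) m.
Proof.
move=> /windowP E le_n; apply/windowP => u lt_u.
by rewrite -!addnA E // (leq_trans _ le_n) // ltn_add2l.
Qed.

(** The prefix of length [(s k).2] recurs at [(s k).1], and the next length is the sum of these two.
    Hence an occurrence of the prefix of length [(s i.+1).2] carries, [(s i).1] letters later, one
    of the prefix of length [(s i).2]; sums are built by adding the smallest index last. *)
Lemma recurrent_prefix_IPset w L :
  (forall N M, exists n, N <= n /\ window w n M = window w 0 M) ->
  IPset (fun n => window w n L = window w 0 L).
Proof.
move=> rec.
have [f fP] := choice (fun NM : nat * nat => rec NM.1 NM.2).
pose s := fix s k := if k is k'.+1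
  then (f ((s k').1.+1, (s k').1 + (s k').2), (s k').1 + (s k').2)
  else (f (0, L), L).
have sP k : window w (s k).1 (s k).2 = window w 0 (s k).2 by case: k => [|k]; apply: (fP _).2.
have s_mono : {homo (fun k => (s k).2) : i j / i <= j}.
  by apply: homo_leq (@leqnn) leq_trans _ => k; apply: leq_addl.
exists (fun k => (s k).1); split=> [k | S uS _].
  by have [] := fP ((s k).1.+1, (s k).1 + (s k).2).
have sort_S : perm_eq S (sort leq S) by rewrite perm_sym perm_sort.
rewrite (perm_big _ sort_S) /=.
have : sorted ltn (sort leq S).
  by rewrite ltn_sorted_uniq_leq sort_uniq uS sort_sorted //; apply: leq_total.
suff main t k : sorted ltn t -> all (leq k) t ->
    window w (\sum_(i <- t) (s i).1) (s k).2 = window w 0 (s k).2.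
  by move=> srt; apply: (main _ 0 srt); apply/allP.
elim: t k => [|i t IHt] k; first by rewrite big_nil.
move=> /= it /andP[le_ki _].
have := IHt i.+1 (path_sorted it) (order_path_min ltn_trans it).
rewrite big_cons addnC => /window_sub E.
rewrite (E (s k).2 (s i).1) ?leq_add2l ?s_mono // -[(s i).1]addn0.
by have := window_sub (sP i); move=> /(_ (s k).2 0); rewrite add0n s_mono // => ->.
Qed.

Theorem theorem4 (w : word) :
  sturmian w -> nonsingular w ->
  (forall u : seq bool, u <> [::] -> factor w u ->
     (IPset (occ w u) <-> is_prefix u w) /\
     (central (occ w u) <-> is_prefix u w)) /\
  (forall v : seq bool, v <> [::] -> is_prefix v w ->
     forall n, occ w v n ->
       IPstar (shiftset (occ w v) n) /\ central_star (shiftset (occ w v) n)).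
Proof.
move=> st ns.
have occE u : occ w u = fun n => window w n (size u) = u.
  by apply/predeqP => n; apply: occurs_atP.
have in_idem p L : Defs.idempotent p -> p (fun n => window w n L = window w 0 L).
  exact: prefix_in_idempotent.
have [e emin] := exists_minimal_idempotent.
split=> [u _ _ | v _ v_pre n].
  have idem_pre p : Defs.idempotent p -> p (occ w u) -> is_prefix u w.
    move=> ip pu; have [n []] := ultra_ex ip.1 (ultraI ip.1 pu (in_idem p (size u) ip)).
    by rewrite occE => nu E; apply/occurs_atP; rewrite -E.
  split; split=> [|/occurs_atP u_pre].
  - by move=> /IPset_idempotent[p ip]; apply: idem_pre.
  - rewrite occE -{2}u_pre; apply: recurrent_prefix_IPset => N M.
    have [eu [enp _]] := emin.1; apply: (ultra_ex eu).
    by apply: ultraI (nonprincipal_ge eu N enp) (in_idem e M emin.1).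
  - by move=> [p [[ip _]]]; apply: idem_pre.
  - by exists e; split=> //; rewrite occE -{2}u_pre; apply: in_idem emin.1.
rewrite occE => vn.
have meets B p : Defs.idempotent p -> p B ->
    exists m, shiftset (fun n => window w n (size v) = v) n m /\ B m.
  (* An occurrence at [m] of the prefix of length [n + size v] carries the occurrence of [v] at [n]
     over to [m + n]. *)
  move=> ip pB; have [m [Bm E]] := ultra_ex ip.1 (ultraI ip.1 pB (in_idem p (n + size v) ip)).
  by exists m; split=> //; rewrite /shiftset (window_sub E) // vn.
split=> B; first by move=> /IPset_idempotent[p ip]; apply: meets.
by move=> [p [[ip _]]]; apply: meets.
Qed.
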